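(* Let $S$ be a densely defined, symmetric, closed operator with nonzero deficiency indices in a separable complex Hilbert space $\mathcal{H}$ with $S\ge\varepsilon I_{\mathcal{H}}$ for some $\varepsilon>0$. Let $S_K$ and $S_F$ be its Krein--von Neumann and Friedrichs extensions, and let $\lambda\ne0$. Then there exists $0\ne v\in\operatorname{dom}(S_K)$ with $$S_Kv=\lambda v$$ if and only if there exists $0\ne u\in\operatorname{dom}(S^*S)$ such that $$S^*Su=\lambda Su.$$ In particular, the solutions $v$ of the first equation are in one-to-one correspondence with the solutions $u$ of the second, given by the formulas $$u=(S_F)^{-1}S_Kv,\qquad v=\lambda^{-1}Su.$$ Moreover, since $S_K\ge0$, any $\lambda\ne0$ for which either equation has a nonzero solution necessarily satisfies $\lambda>0$.
   Context: For nonnegative self-adjoint $A,B$, $A\le B$ means $\operatorname{dom}(B^{1/2})\subseteq\operatorname{dom}(A^{1/2})$ and $\|A^{1/2}u\|\le\|B^{1/2}u\|$ for $u\in\operatorname{dom}(B^{1/2})$. The Krein--von Neumann extension $S_K$ and the Friedrichs extension $S_F$ are, respectively, the smallest and the largest nonnegative self-adjoint extension of $S$. Since $S\ge\varepsilon I_{\mathcal{H}}$, one has $S_F\ge\varepsilon I_{\mathcal{H}}$, $\operatorname{dom}(S_K)=\operatorname{dom}(S)\dotplus\ker(S^* )$, $S_K=S^*|_{\operatorname{dom}(S_K)}$. *)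

(* Defs.v *)
From HB Require Import structures.
From mathcomp Require Import all_boot all_order all_algebra.
From mathcomp Require Import sesquilinear complex.
From mathcomp Require Import all_classical all_reals all_analysis.
Set Implicit Arguments.
Unset Strict Implicit.
Unset Printing Implicit Defensive.
Import Order.TTheory GRing.Theory Num.Theory.
Import numFieldNormedType.Exports.

Local Open Scope classical_set_scope.
Local Open Scope ring_scope.
Local Open Scope complex_scope.

Definition separable (T : topologicalType) : Prop :=
  exists D : set T, countable D /\ dense D.

Section UnboundedOperators.
Context {R : realType} {H : completeNormedModType R[i]}.

(* A partially defined operator in H is represented by its graph, so that
   extension is inclusion of graphs and equality of operators, domains
   included, is equality. *)
Implicit Types A B S T : set (H * H).

Definition dom A : set H := [set u | exists w, A (u, w)].

(* The value A u; only meaningful for u in dom A. *)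
Definition app A (u : H) : H := xget 0 [set w | A (u, w)].

Definition is_operator A : Prop :=
  [/\ A 0,
      forall (a : R[i]) p q, A p -> A q -> A (a *: p + q)
    & forall u w w', A (u, w) -> A (u, w') -> w = w'].

Definition densely_defined A : Prop := dense (dom A).

Definition comp_op B A : set (H * H) :=
  [set p | exists w, A (p.1, w) /\ B (w, p.2)].

Definition inv_op A : set (H * H) := [set p | A (p.2, p.1)].

Definition ker A : set H := [set u | A (u, 0)].

(* A - z I *)
Definition shift_op A (z : R[i]) : set (H * H) :=
  [set p | A (p.1, p.2 + z *: p.1)].

Definition lin_indep n (e : 'I_n -> H) : Prop :=
  forall c : 'I_n -> R[i], \sum_i c i *: e i = 0 -> forall i, c i = 0.

(* Dimension of a linear subspace, +oo when it is infinite. *)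
Definition dimension (V : set H) : \bar R :=
  ereal_sup [set n%:R%:E | n in
    [set n : nat | exists e : 'I_n -> H, lin_indep e /\ forall i, V (e i)]].

(* The inner product is linear in its first argument and antilinear in the
   second one. *)
Variable ip : {dot H for Num.conj}.

(* (u, w) is in the graph iff <A x, u> = <x, w> for all x in dom A. *)
Definition adj A : set (H * H) :=
  [set p | forall q, A q -> ip q.2 p.1 = ip q.1 p.2].

Definition symmetric_op A : Prop := A `<=` adj A.

Definition self_adjoint A : Prop :=
  [/\ is_operator A, densely_defined A & adj A = A].

(* A >= e I. The order of R[i] makes <A u, u> real as well. *)
Definition bounded_below A (e : R) : Prop :=
  forall u w, A (u, w) -> e%:C * `|u| ^+ 2 <= ip w u.

Definition nonneg_self_adjoint A : Prop :=
  self_adjoint A /\ bounded_below A 0.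

(* dim ker (S^* - z I), for z = 'i%C and z = - 'i%C *)
Definition deficiency_index S (z : R[i]) : \bar R :=
  dimension (ker (shift_op (adj S) z)).

(* Q = A^{1/2}. For A nonnegative self-adjoint such a Q exists and is unique,
   by the spectral theorem. *)
Definition is_sqrt_op A (Q : set (H * H)) : Prop :=
  nonneg_self_adjoint Q /\ comp_op Q Q = A.

(* A <= B for nonnegative self-adjoint A and B. *)
Definition le_op A B : Prop :=
  exists QA QB, [/\ is_sqrt_op A QA, is_sqrt_op B QB, dom QB `<=` dom QA
    & forall u, dom QB u -> `|app QA u| <= `|app QB u| ].

Definition nonneg_sa_extension S T : Prop :=
  nonneg_self_adjoint T /\ S `<=` T.

Definition is_krein_extension S K : Prop :=
  nonneg_sa_extension S K /\
  forall T, nonneg_sa_extension S T -> le_op K T.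

Definition is_friedrichs_extension S F : Prop :=
  nonneg_sa_extension S F /\
  forall T, nonneg_sa_extension S T -> le_op T F.

(* Solution sets of K v = lam v and of S^* S u = lam S u; both contain 0. *)
Definition eigen_solutions (K : set (H * H)) (lam : R[i]) : set H :=
  [set v | dom K v /\ app K v = lam *: v].

Definition pencil_solutions S (lam : R[i]) : set H :=
  [set u | dom (comp_op (adj S) S) u /\
           app (comp_op (adj S) S) u = lam *: app S u].

End UnboundedOperators.

(* Main.v *)
Require Import Defs.
From HB Require Import structures.
From mathcomp Require Import all_boot all_order all_algebra.
From mathcomp Require Import sesquilinear complex.
From mathcomp Require Import all_classical all_reals all_analysis.
From mathcomp Require Import ring lra.
Set Implicit Arguments.
Unset Strict Implicit.
Unset Printing Implicit Defensive.
Import Order.TTheory GRing.Theory Num.Theory.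
Import numFieldNormedType.Exports.
Local Open Scope classical_set_scope.
Local Open Scope ring_scope.
Local Open Scope complex_scope.

(* Write S_K as the restriction of S^* to dom S + ker S^*. If S_K v = lam v, then
   lam v = S u for some u in dom S with v - u in ker S^*, so S^* S u = lam S^* v
   = lam S u; conversely v = lam^-1 S u satisfies S^* (v - u) = 0.
   An inequality A <= B of forms gives ker B <= ker A, and this is all that is
   used of the extremality of S_K and S_F. Compared with the restriction of S^*
   above, which is nonnegative and self-adjoint, minimality gives
   ker S^* <= ker S_K and hence determines S_K; compared with an explicit
   injective nonnegative self-adjoint extension, maximality gives
   ker S_F = 0. *)

(** * Inner product and its real part *)

Section InnerProduct.
Context {R : realType} {H : completeNormedModType R[i]}.
Variable ip : {dot H for Num.conj}.
Hypothesis normE : forall x : H, `|x| ^+ 2 = ip x x.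

Lemma ipC x y : ip x y = (ip y x)^*%C.
Proof. by rewrite hermC expr0 mul1r. Qed.

Lemma ipDl x y z : ip (x + y) z = ip x z + ip y z.
Proof. exact: linearDl. Qed.

Lemma ipDr x y z : ip x (y + z) = ip x y + ip x z.
Proof. exact: linearDr. Qed.

Lemma ipBl x y z : ip (x - y) z = ip x z - ip y z.
Proof. exact: linearBl. Qed.

Lemma ipBr x y z : ip x (y - z) = ip x y - ip x z.
Proof. exact: linearBr. Qed.

Lemma ipNl x y : ip (- x) y = - ip x y.
Proof. exact: linearNl. Qed.

Lemma ipZl a x y : ip (a *: x) y = a * ip x y.
Proof. exact: linearZl_LR. Qed.

Lemma ipZr a x y : ip x (a *: y) = a^*%C * ip x y.
Proof. exact: linearZr_LR. Qed.

Lemma ip0l x : ip 0 x = 0.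
Proof. exact: linear0l. Qed.

Lemma ip0r x : ip x 0 = 0.
Proof. exact: linear0r. Qed.

Lemma ip_ge0 x : 0 <= ip x x.
Proof. by rewrite -normE exprn_ge0. Qed.

Lemma ip_eq0 x : ip x x = 0 -> x = 0.
Proof. by rewrite -normE => /eqP; rewrite expf_eq0 /= normr_eq0 => /eqP. Qed.

(** Real values give access to infima and linear arithmetic, while [rip x x] is still the squared
    norm. *)
Definition rip x y : R := complex.Re (ip x y).

Lemma ripC x y : rip x y = rip y x.
Proof. by rewrite /rip ipC; case: (ip y x). Qed.

Lemma ripDl x y z : rip (x + y) z = rip x z + rip y z.
Proof. by rewrite /rip ipDl raddfD. Qed.

Lemma ripDr x y z : rip x (y + z) = rip x y + rip x z.
Proof. by rewrite /rip ipDr raddfD. Qed.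

Lemma ripBl x y z : rip (x - y) z = rip x z - rip y z.
Proof. by rewrite /rip ipBl raddfB. Qed.

Lemma ripBr x y z : rip x (y - z) = rip x y - rip x z.
Proof. by rewrite /rip ipBr raddfB. Qed.

Lemma ripZl (a : R) x y : rip (a%:C *: x) y = a * rip x y.
Proof. by rewrite /rip ipZl; case: (ip x y) => u v /=; rewrite mul0r subr0. Qed.

Lemma ripZr (a : R) x y : rip x (a%:C *: y) = a * rip x y.
Proof. by rewrite ripC ripZl ripC. Qed.

Lemma ripE x : ip x x = (rip x x)%:C.
Proof.
by rewrite /rip RRe_real// ger0_real// ip_ge0.
Qed.

Lemma rip_ge0 x : 0 <= rip x x.
Proof. by rewrite -lecR -ripE ip_ge0. Qed.

Lemma rip_eq0 x : rip x x = 0 -> x = 0.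
Proof. by move=> h; apply: ip_eq0; rewrite ripE h. Qed.

Lemma norm_lt_rip x (e : R) : 0 < e -> (`|x| < e%:C) = (rip x x < e ^+ 2).
Proof.
move=> e0; rewrite -(@ltr_pXn2r _ 2)// ?nnegrE// ?lecR ?ltW//.
by rewrite normE ripE -rmorphXn ltcR.
Qed.

(** Expand [|s x - y|^2 >= 0] and divide by [s]. *)
Lemma rip_young (s : R) x y : 0 < s ->
  2 * rip x y <= s * rip x x + s^-1 * rip y y.
Proof.
move=> s0; have s_neq0 : s != 0 by rewrite gt_eqF.
have := rip_ge0 (s%:C *: x - y).
rewrite !ripBl !ripBr !ripZl !ripZr (ripC y x) => h.
rewrite -subr_ge0.
suff -> : s * rip x x + s^-1 * rip y y - 2 * rip x y =
   s^-1 * (s * (s * rip x x) - s * rip x y - (s * rip x y - rip y y)).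
  by rewrite mulr_ge0// invr_ge0 ltW.
by field.
Qed.

(** * Convergence in the squared norm *)

Lemma cvg_rip (u : nat -> H) (l : H) (e : R) : 0 < e -> u @ \oo --> l ->
  \forall k \near \oo, rip (u k - l) (u k - l) < e.
Proof.
move=> e0 ul; have se0 : 0 < Num.sqrt e by rewrite sqrtr_gt0.
have se0' : 0 < (Num.sqrt e)%:C by rewrite ltcR.
have /cvgrPdistC_lt/(_ _ se0') := ul; apply: filterS => k.
by rewrite norm_lt_rip// sqr_sqrtr// ltW.
Qed.

Lemma rip_cauchy_cvg (u : nat -> H) (C : R) :
  (forall i j, rip (u i - u j) (u i - u j) <= C * (i.+1%:R^-1 + j.+1%:R^-1)) ->
  cvg (u @ \oo).
Proof.
move=> hu; apply/cauchy_cvgP/cauchy_exP => e e0.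
have [r r0 {e e0}->] : exists2 r : R, 0 < r & e = r%:C.
  exists (complex.Re e); first by move: e0; rewrite ltcE => /andP[].
  by rewrite RRe_real// gtr0_real.
(* Chosen so that [(|C| + 1) * (2 * d) = r ^+ 2]; the sign of [C] is arbitrary, hence [|C| + 1]. *)
pose d := r ^+ 2 / (2 * (`|C| + 1)).
have d0 : 0 < d.
  by rewrite divr_gt0 ?exprn_gt0// mulr_gt0// ltr_wpDl.
have [N _ hN] := near_infty_natSinv_lt (PosNum d0).
exists (u N); exists N => // k /= Nk.
rewrite -ball_normE /= norm_lt_rip//; apply: le_lt_trans (hu N k) _.
have /= hNN := hN N (leqnn N); have /= hNk := hN k Nk.
have N0 : 0 <= N.+1%:R^-1 :> R by rewrite invr_ge0.
have k0 : 0 <= k.+1%:R^-1 :> R by rewrite invr_ge0.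
have -> : r ^+ 2 = (`|C| + 1) * (2 * d).
  by rewrite /d; field; rewrite gt_eqF// ltr_wpDl.
apply: (@le_lt_trans _ _ ((`|C| + 1) * (N.+1%:R^-1 + k.+1%:R^-1))).
  by rewrite ler_wpM2r ?addr_ge0// (le_trans (ler_norm C))// lerDl.
rewrite ltr_pM2l ?ltr_wpDl//.
by rewrite mulr_natl mulr2n; exact: ltrD.
Qed.

(** * Linear graphs and a variational problem *)

Implicit Types G : set (H * H).

(** Single-valuedness is left out, so that adjoints of arbitrary graphs qualify. *)
Definition linear_graph G : Prop :=
  G 0 /\ forall (a : R[i]) p q, G p -> G q -> G (a *: p + q).

Lemma graphZ G a p : linear_graph G -> G p -> G (a *: p).
Proof. by move=> [G0 GP] Gp; have := GP a p 0 Gp G0; rewrite addr0. Qed.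

Lemma graphD G p q : linear_graph G -> G p -> G q -> G (p + q).
Proof. by move=> [_ GP] Gp Gq; rewrite -[p]scale1r; apply: GP. Qed.

Lemma graphB G p q : linear_graph G -> G p -> G q -> G (p - q).
Proof.
by move=> Gl Gp Gq; rewrite -scaleN1r; apply: graphD => //; exact: graphZ.
Qed.

(* Minimizes |y|^2 - 2 Re (<x, n> + <y, w>) over (x, y) in G; by the
   parallelogram law every minimizing sequence is Cauchy. *)
Lemma closed_graph_representation G (d : R) (n w : H) :
  linear_graph G -> closed G -> 0 < d ->
  (forall x y, G (x, y) -> d * rip x x <= rip y y) ->
  exists f g, G (f, g) /\ adj ip G (g - w, n).
Proof.
move=> Gl Gc d0 Gd.
pose J (q : H * H) := rip q.2 q.2 - 2 * (rip q.1 n + rip q.2 w).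
pose E := [set J q | q in G].
have lbJ : has_lbound E.
  (* Young with weights [d / 2] on [x] and [1 / 2] on [y]: by coercivity the two costs together use
     up exactly [|y|^2]. *)
  exists (- ((d / 2)^-1 * rip n n + (2^-1)^-1 * rip w w)) => _ [[x y] Gxy <-].
  rewrite /J/=.
  have d2 : 0 < d / 2 by rewrite divr_gt0.
  have h2 : 0 < 2^-1 :> R by rewrite invr_gt0.
  have := rip_young x n d2; have := rip_young y w h2; have := Gd _ _ Gxy.
  by move: (_^-1 * rip n n) (_^-1 * rip w w) => a b; lra.
have infJ : has_inf E by split=> //; exists (J 0); exists 0 => //; case: Gl.
set m := inf E.
have mJ q : G q -> m <= J q by move=> Gq; apply: ge_inf => //; exists q.
have /choice[p hp] : forall k : nat, exists q, G q /\ J q < m + k.+1%:R^-1.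
  move=> k; have k0 : 0 < k.+1%:R^-1 :> R by rewrite invr_gt0.
  by have [_ [q Gq <-] Jq] := inf_adherent k0 infJ; exists q.
have parallelogram q q' : G q -> G q' ->
    rip (q.2 - q'.2) (q.2 - q'.2) <= 2 * (J q + J q' - 2 * m).
  move=> Gq Gq'.
  (* At the midpoint of [q] and [q'] the linear terms of [J] cancel. *)
  have := mJ _ (graphZ (2^-1)%:C Gl (graphD Gl Gq Gq')).
  rewrite /J /= !ripZl !ripZr !(ripBl, ripBr, ripDl, ripDr) (ripC q'.2 q.2).
  by lra.
have cvg2 : cvg ((fun k => (p k).2) @ \oo).
  apply: (@rip_cauchy_cvg _ 2) => i j.
  have [Gi Ji] := hp i; have [Gj Jj] := hp j.
  have := parallelogram _ _ Gi Gj.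
  by move: (i.+1%:R^-1) (j.+1%:R^-1) Ji Jj => a b; lra.
(* Coercivity carries the Cauchy bound from second components to first ones, at the price of a
   factor [1 / d]. *)
have cvg1 : cvg ((fun k => (p k).1) @ \oo).
  apply: (@rip_cauchy_cvg _ (2 / d)) => i j.
  have [Gi Ji] := hp i; have [Gj Jj] := hp j.
  have := parallelogram _ _ Gi Gj.
  have := Gd ((p i).1 - (p j).1) ((p i).2 - (p j).2).
  move=> /(_ (graphB Gl Gi Gj)) /=.
  set a := rip _ _; set b := rip _ _ => dab bJ.
  have -> : 2 / d * (i.+1%:R^-1 + j.+1%:R^-1) =
      d^-1 * (2 * (i.+1%:R^-1 + j.+1%:R^-1)) by rewrite [2 / d]mulrC -mulrA.
  rewrite -ler_pdivrMl ?invr_gt0// invrK.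
  by move: (i.+1%:R^-1) (j.+1%:R^-1) Ji Jj => a' b'; lra.
set f := lim ((fun k => (p k).1) @ \oo) in cvg1.
set g := lim ((fun k => (p k).2) @ \oo) in cvg2.
have Gfg : G (f, g).
  apply: (closed_cvg (F := \oo) (u_ := fun k => ((p k).1, (p k).2)) _ Gc).
    by apply: nearW => k; rewrite -surjective_pairing; have [] := hp k.
  by apply: cvg_pair.
exists f, g; split=> //.
have Re0 q : G q -> rip q.2 (g - w) = rip q.1 n.
  move=> Gq; apply/eqP; rewrite -subr_eq0; apply/eqP.
  set r := _ - _.
  (* Compare [J (t q + p k) >= m] with [J (p k) < m + 1 / (k + 1)]. Replacing [(p k).2] by [g] costs
     a cross term, which Young bounds by [t^2 |q.2|^2] plus a vanishing term; hence the factor 2 on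
     [t ^+ 2]. *)
  have quad (t : R) : 0 <= 2 * t ^+ 2 * rip q.2 q.2 + 2 * t * r.
    rewrite -(mulr0 2); apply/ler_addgt0Pr => e e0.
    have e20 : 0 < e / 2 by rewrite divr_gt0.
    near \oo => k.
    have [Gk Jk] := hp k.
    have := mJ _ (graphD Gl (graphZ t%:C Gl Gq) Gk).
    have := rip_young (t%:C *: q.2) ((p k).2 - g) ltr01.
    have : rip ((p k).2 - g) ((p k).2 - g) < e / 2.
      by near: k; exact: cvg_rip cvg2.
    have : k.+1%:R^-1 < e / 2.
      by near: k; exact: near_infty_natSinv_lt (PosNum e20).
    move: (k.+1%:R^-1) Jk => c; rewrite /J /r /= invr1.
    rewrite !(ripBl, ripBr, ripDl, ripDr) !ripZl !ripZr.
    rewrite (ripC (p k).2 q.2) (ripC g (p k).2); lra.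
  have Q0 := rip_ge0 q.2; move: Q0 quad; set Q := rip q.2 q.2 => Q0 quad.
  (* At [t = - s r / 2] the quadratic is [s r^2 (s Q / 2 - 1)] with [s Q < 1], which forces [r = 0].
     Taking [Q + 1] covers [Q = 0]. *)
  have Q1 : 0 < Q + 1 by lra.
  pose s := (Q + 1)^-1; have s0 : 0 < s by rewrite invr_gt0.
  have sQ : s * (Q + 1) = 1 by rewrite mulVf// gt_eqF.
  have := quad (- (s * r) / 2) => h.
  have : 0 <= s * (r ^+ 2 * (s * Q / 2 - 1)) by nra.
  by rewrite pmulr_rge0//; nra.
move=> q Gq; apply/eqP; rewrite eq_complex.
apply/andP; split; first by apply/eqP; exact: Re0.
(* The imaginary part is the real identity at [i q]. *)
have := Re0 _ (graphZ 'i%C Gl Gq); rewrite /rip /= !ipZl.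
by case: (ip _ _) => a b; case: (ip _ _) => a' b' /=; lra.
Unshelve. all: by end_near. Qed.

(** * Adjoints, self-adjointness and the order of forms *)

Implicit Types A B S T : set (H * H).

Lemma is_operatorP A : is_operator A <->
  linear_graph A /\ (forall u w w', A (u, w) -> A (u, w') -> w = w').
Proof. by split=> [[A0 AP Af]|[[A0 AP] Af]]. Qed.

Lemma app_graph A u w : is_operator A -> A (u, w) -> app A u = w.
Proof.
by move=> [_ _ Af] Auw; apply: xget_unique => // w' Auw'; exact: Af Auw' Auw.
Qed.

Lemma graph_app A u : dom A u -> A (u, app A u).
Proof. by move=> Au; exact: xgetPex Au. Qed.

Lemma linear_graph_adj A : linear_graph (adj ip A).
Proof.
split=> [q _|a p q Ap Aq r Ar] /=; first by rewrite !ip0r.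
by rewrite !ipDr !ipZr Ap// Aq.
Qed.

Lemma adjS A B : A `<=` B -> adj ip B `<=` adj ip A.
Proof. by move=> AB p Bp q Aq; apply: Bp; exact: AB. Qed.

Lemma densely_definedS A B : A `<=` B -> densely_defined A -> densely_defined B.
Proof.
move=> AB Ad O O0 Oo; have [u [Ou [w Auw]]] := Ad O O0 Oo.
by exists u; split=> //; exists w; exact: AB.
Qed.

(** If [z] were nonzero, some [x] in [D] would satisfy [|z - x| < |z|], but orthogonality gives
    [|z - x|^2 = |z|^2 + |x|^2]. *)
Lemma dense_ortho_eq0 (D : set H) z :
  dense D -> (forall x, D x -> ip x z = 0) -> z = 0.
Proof.
move=> Dd Dz; apply: contrapT => /eqP z0.
have nz : 0 < `|z| by rewrite normr_gt0.
have [|x [zx Dx]] := Dd (ball z `|z|) _ (ball_open _ _).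
  by exists z; exact: ballxx.
move: zx; rewrite -ball_normE /= -(@ltr_pXn2r _ 2)// ?nnegrE// !normE.
rewrite ipBl !ipBr (ipC z x) (Dz x Dx) conjc0 subr0 sub0r opprK.
by rewrite gtrDl (le_gtF (ip_ge0 x)).
Qed.

Lemma adj_functional A u w w' : densely_defined A ->
  adj ip A (u, w) -> adj ip A (u, w') -> w = w'.
Proof.
move=> Ad Aw Aw'; apply/eqP; rewrite -subr_eq0; apply/eqP.
apply: (dense_ortho_eq0 Ad) => x [y Axy].
by rewrite ipBr -(Aw _ Axy) -(Aw' _ Axy) /= subrr.
Qed.

Lemma is_operator_sub_adj A B : densely_defined A -> linear_graph B ->
  B `<=` adj ip A -> is_operator B.
Proof.
move=> Ad Bl BA; apply/is_operatorP; split=> // u w w' /BA Bw /BA Bw'.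
exact: adj_functional Bw Bw'.
Qed.

(** The order of [R[i]] also demands that [<A u, u>] be real; symmetry supplies this. *)
Lemma symmetric_bounded_below A (e : R) : symmetric_op ip A ->
  (forall u w, A (u, w) -> e * rip u u <= rip w u) -> bounded_below ip A e.
Proof.
move=> As Ae u w Auw; have /= := As _ Auw _ Auw => wu.
have : ip w u \is Num.real by apply/CrealP; rewrite [RHS]wu [RHS]ipC.
by rewrite normE ripE -rmorphM => /RRe_real <-; rewrite lecR; exact: Ae.
Qed.

Lemma bounded_below_rip A (e : R) u w :
  bounded_below ip A e -> A (u, w) -> e * rip u u <= rip w u.
Proof.
by move=> Ae /Ae; rewrite normE ripE -rmorphM lecE => /andP[].
Qed.

(** If [A^* u = w], choose [v] with [A v = w]; then [u - v] is orthogonal to the range of [A], which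
    is everything. *)
Lemma self_adjoint_surjective A : linear_graph A -> densely_defined A ->
  symmetric_op ip A -> (forall w, exists u, A (u, w)) -> self_adjoint ip A.
Proof.
move=> Al Ad As Asurj; split=> //; first exact: is_operator_sub_adj As.
apply/seteqP; split=> // -[u w] uw.
have [v Avw] := Asurj w.
suff -> : u = v by [].
apply/eqP; rewrite -subr_eq0; apply/eqP/ip_eq0.
have [x Ax] := Asurj (u - v).
by rewrite ipBr (uw _ Ax) (As _ Avw _ Ax) subrr.
Qed.

(** Adjoints reverse inclusion, so [B = B^*] lies in [A^* = A]. *)
Lemma sub_self_adjoint_eq A B :
  self_adjoint ip A -> self_adjoint ip B -> A `<=` B -> A = B.
Proof.
move=> [_ _ Aa] [_ _ Ba] AB; apply/seteqP; split=> //.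
by have := adjS AB; rewrite Aa Ba.
Qed.

(** If [Q (Q u) = 0], then [|Q u|^2 = <u, Q (Q u)> = 0]. *)
Lemma ker_sqrt_op A Q : is_sqrt_op ip A Q -> ker A = ker Q.
Proof.
move=> [[[/is_operatorP[[Q0 _] _] _ Qa] _] <-].
apply/seteqP; split=> [u [w /= [Quw Qw0]]|u Qu]; last by exists 0.
suff w0 : w = 0 by rewrite w0 in Quw.
by apply: ip_eq0; move: Qw0; rewrite -{1}Qa => /(_ _ Quw) /=; rewrite ip0r.
Qed.

Lemma ker_le_op A B : le_op ip A B -> ker B `<=` ker A.
Proof.
move=> [QA [QB [sA sB dBA nBA]]]; rewrite (ker_sqrt_op sA) (ker_sqrt_op sB).
move=> u QBu0; have dBu : dom QB u by exists 0.
have := graph_app (dBA u dBu); have := nBA u dBu.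
have [[[QBop _ _] _] _] := sB.
by rewrite (app_graph QBop QBu0) normr0 normr_le0 => /eqP ->.
Qed.

(** * Consequences of a positive lower bound *)

Section PositiveOperator.
Variables (S : set (H * H)) (eps : R).
Hypotheses (S_op : is_operator S) (S_dense : densely_defined S)
  (S_sym : symmetric_op ip S) (S_closed : closed S)
  (eps_gt0 : 0 < eps) (S_ge : bounded_below ip S eps).

Let S_lin : linear_graph S. Proof. by have /is_operatorP[] := S_op. Qed.

Let Sa_lin : linear_graph (adj ip S). Proof. exact: linear_graph_adj. Qed.

Lemma bounded_below_coercive x y : S (x, y) -> eps ^+ 2 * rip x x <= rip y y.
Proof.
move=> /(bounded_below_rip S_ge); rewrite ripC => h.
have := rip_young x y eps_gt0 => h'.
have : eps * rip x x <= eps^-1 * rip y y by lra.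
by rewrite -ler_pdivrMl ?invr_gt0// invrK mulrA -expr2.
Qed.

(** The case [n = 0] of the variational problem: [g] is the orthogonal projection of [w] onto the
    range of [S]. *)
Lemma range_ker_adj_decomposition w :
  exists f g, S (f, g) /\ adj ip S (w - g, 0).
Proof.
have [f [g [Sfg ag]]] := closed_graph_representation 0 w S_lin S_closed
  (exprn_gt0 2 eps_gt0) bounded_below_coercive.
exists f, g; split=> //.
have := graphZ (-1) Sa_lin ag.
suff -> : -1 *: (g - w, 0) = (w - g, 0) :> H * H by [].
by congr pair; rewrite /= ?scaler0// scaleN1r opprB.
Qed.

(** The case [w = 0]: it solves [S^* S f = n]. *)
Lemma adj_surjective_range n : exists f g, S (f, g) /\ adj ip S (g, n).
Proof.
have [f [g [Sfg ag]]] := closed_graph_representation n 0 S_lin S_closed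
  (exprn_gt0 2 eps_gt0) bounded_below_coercive.
by exists f, g; rewrite subr0 in ag.
Qed.

(** * Two nonnegative self-adjoint extensions *)

Lemma range_ortho_ker_adj f g n : S (f, g) -> adj ip S (n, 0) -> ip g n = 0.
Proof. by move=> Sfg /(_ _ Sfg) /=; rewrite ip0r. Qed.

(** The restriction of [S^*] to [dom S + ker S^*]: for [u = f + (u - f)] the value [S^* u] is
    [S f]. *)
Definition krein_op : set (H * H) :=
  [set p | exists f, S (f, p.2) /\ adj ip S (p.1 - f, 0)].

Lemma krein_op_sub_adj : krein_op `<=` adj ip S.
Proof.
move=> [u w] [f /= [Sfw auf]].
have : adj ip S (f + (u - f), w + 0) := graphD Sa_lin (S_sym Sfw) auf.
by rewrite addr0 addrC subrK.
Qed.

Lemma sub_krein_op : S `<=` krein_op.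
Proof.
by move=> [u w] Suw; exists u; split=> //=; rewrite subrr; case: Sa_lin.
Qed.

Lemma krein_op_symmetric : symmetric_op ip krein_op.
Proof.
move=> p [f [Sf af]] q [f' [Sf' af']].
rewrite -(subrK f p.1) -(subrK f' q.1) ipDr ipDl.
rewrite (range_ortho_ker_adj Sf' af) (ipC _ p.2) (range_ortho_ker_adj Sf af').
by rewrite conjc0 !add0r (S_sym Sf Sf').
Qed.

Lemma krein_op_nonneg_sa_extension : nonneg_sa_extension ip S krein_op.
Proof.
have Kd := densely_definedS sub_krein_op S_dense.
split; last exact: sub_krein_op.
split; last first.
  apply: symmetric_bounded_below krein_op_symmetric _ => u w [f /= [Sfw auf]].
  rewrite mul0r -(subrK f u) ripDr {1}/rip (range_ortho_ker_adj Sfw auf) add0r.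
  have := bounded_below_rip S_ge Sfw; apply: le_trans.
  by rewrite mulr_ge0 ?rip_ge0 ?ltW.
split=> //.
  apply: is_operator_sub_adj S_dense _ krein_op_sub_adj.
  split=> [|a p q [f [Sf af]] [f' [Sf' af']]].
    by apply: sub_krein_op; case: S_lin.
  exists (a *: f + f'); split.
    by have := S_lin.2 a _ _ Sf Sf'.
  have : adj ip S (a *: (p.1 - f) + (q.1 - f'), a *: 0 + 0).
    by have := Sa_lin.2 a _ _ af af'.
  rewrite scaler0 addr0.
  by rewrite scalerBr addrACA opprD.
apply/seteqP; split; last exact: krein_op_symmetric.
move=> [u w] uw.
have [f [g [Sfg ag]]] := range_ker_adj_decomposition w.
(* Since [ker S^*] lies in the kernel of [krein_op], [w] is orthogonal to it, as is [g]; hence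
   [w - g], which belongs to [ker S^*], is orthogonal to itself. *)
have wg : w = g.
  apply/eqP; rewrite -subr_eq0; apply/eqP/ip_eq0.
  rewrite ipBr (ipC _ g) (range_ortho_ker_adj Sfg ag) conjc0 subr0.
  have Kw : krein_op (w - g, 0).
    by exists 0; rewrite /= subr0; split=> //; case: S_lin.
  by rewrite -(uw _ Kw) ip0l.
exists f => /=; rewrite wg; split=> //.
have : adj ip S (u - f, w - g).
  exact: graphB Sa_lin (adjS sub_krein_op uw) (S_sym Sfg).
by rewrite wg subrr.
Qed.

(* The inverse of this operator extends S^-1 to H = ran S + ker S^* by the
   block c = 2 / eps on ker S^*; any c > 1 / eps makes it injective and
   nonnegative. *)
Definition positive_extension : set (H * H) :=
  [set p | exists f g n a b, [/\ S (f, g), adj ip S (n, 0),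
     S (b, a) /\ adj ip S (a, n), p.1 = f + a + (2 / eps)%:C *: n
   & p.2 = g + n]].

Lemma sub_positive_extension : S `<=` positive_extension.
Proof.
move=> [u w] Suw; exists u, w, 0, 0, 0; rewrite /= scaler0 !addr0.
by split=> //; case: Sa_lin => //; case: S_lin.
Qed.

Lemma positive_extension_linear : linear_graph positive_extension.
Proof.
split=> [|t p q [f [g [n [a [b [Sf kn [Sb an] Ep Ep']]]]]]].
  by apply: sub_positive_extension; case: S_lin.
move=> [f' [g' [n' [a' [b' [Sf' kn' [Sb' an'] Eq Eq']]]]]].
exists (t *: f + f'), (t *: g + g'), (t *: n + n'), (t *: a + a'),
  (t *: b + b').
split.
- by have := S_lin.2 t _ _ Sf Sf'.
- have : adj ip S (t *: n + n', t *: 0 + 0) by have := Sa_lin.2 t _ _ kn kn'.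
  by rewrite scaler0 addr0.
- split; first by have := S_lin.2 t _ _ Sb Sb'.
  by have := Sa_lin.2 t _ _ an an'.
- rewrite /= Ep Eq !scalerDr !scalerA [_ * t]mulrC.
  by rewrite addrACA; congr (_ + _); exact: addrACA.
- by rewrite /= Ep' Eq' scalerDr addrACA.
Qed.

(** The term [a] is the off-diagonal block that balances the [ker S^*] component of [f]:
    [<g', a> = <f', n>] because [S^* a = n]. As [a = S b], it is orthogonal to [ker S^*]. *)
Lemma positive_extension_symmetric : symmetric_op ip positive_extension.
Proof.
move=> [u w] [f [g [n [a [b [Sf kn [Sb an] /= -> ->]]]]]].
move=> [u' w'] [f' [g' [n' [a' [b' [Sf' kn' [Sb' an'] /= -> ->]]]]]].
have ga : ip g' a = ip f' n := an _ Sf'.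
have ag : ip a' g = ip n' f by rewrite ipC (an' _ Sf) /= -ipC.
have na : ip n' a = 0 by rewrite ipC (range_ortho_ker_adj Sb kn') conjc0.
have ng : ip n' g = 0 by rewrite ipC (range_ortho_ker_adj Sf kn') conjc0.
rewrite !(ipDl, ipDr) !ipZl !ipZr conjc_real ga ag na ng (S_sym Sf Sf') /=.
rewrite (range_ortho_ker_adj Sf' kn) (range_ortho_ker_adj Sb' kn).
ring.
Qed.

(** The form is [<g, f> + 2 Re <f, n> + (2 / eps) |n|^2]. Young bounds the cross term by
    [eps |f|^2 + |n|^2 / eps], leaving at least [|n|^2 / eps]. *)
Lemma positive_extension_ge0 u w : positive_extension (u, w) -> 0 <= rip w u.
Proof.
move=> [f [g [n [a [b [Sf kn [Sb an] /= -> ->]]]]]].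
have ga : rip g a = rip f n by rewrite /rip (an _ Sf).
have gn : rip g n = 0 by rewrite /rip (range_ortho_ker_adj Sf kn).
have na : rip n a = 0 by rewrite ripC /rip (range_ortho_ker_adj Sb kn).
rewrite !(ripDl, ripDr) !ripZr ga gn na (ripC n f).
have := bounded_below_rip S_ge Sf; have := rip_young f (- n) eps_gt0.
have -> : rip f (- n) = - rip f n by rewrite -(sub0r n) ripBr /rip ip0r sub0r.
have -> : rip (- n) (- n) = rip n n by rewrite /rip hnormN.
have : 0 <= eps^-1 * rip n n by rewrite mulr_ge0 ?rip_ge0// invr_ge0 ltW.
rewrite -mulrA; lra.
Qed.

Lemma positive_extension_nonneg_sa_extension :
  nonneg_sa_extension ip S positive_extension.
Proof.
split; last exact: sub_positive_extension.
split; last first.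
  apply: symmetric_bounded_below positive_extension_symmetric _ => u w.
  by rewrite mul0r; exact: positive_extension_ge0.
apply: self_adjoint_surjective => //.
- exact: positive_extension_linear.
- exact: densely_definedS sub_positive_extension S_dense.
- exact: positive_extension_symmetric.
(* Split [w = g + n] along [ran S + ker S^*], then solve [S^* S b = n]. *)
- move=> w; have [f [g [Sf ag]]] := range_ker_adj_decomposition w.
  have [b [a [Sb an]]] := adj_surjective_range (w - g).
  exists (f + a + (2 / eps)%:C *: (w - g)); exists f, g, (w - g), a, b.
  by split=> //=; rewrite addrC subrK.
Qed.

(** The orthogonal vectors [g] and [n] sum to 0, so both vanish; then [f = 0] by the lower bound and
    [|a|^2 = <b, n> = 0]. *)
Lemma ker_positive_extension u : ker positive_extension u -> u = 0.
Proof.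
move=> [f [g [n [a [b [Sf kn [Sb an] /= -> /eqP]]]]]].
rewrite eq_sym addr_eq0 => /eqP gE.
have n0 : n = 0.
  apply/ip_eq0/oppr_inj.
  by rewrite -ipNl -gE (range_ortho_ker_adj Sf kn) oppr0.
have g0 : g = 0 by rewrite gE n0 oppr0.
have f0 : f = 0.
  apply: rip_eq0; apply/eqP; rewrite eq_le rip_ge0 andbT.
  have := bounded_below_rip S_ge Sf.
  by rewrite g0 {2}/rip ip0l pmulr_rle0.
have a0 : a = 0.
  by apply: ip_eq0; rewrite (an _ Sb) n0 ip0r.
by rewrite f0 n0 a0 scaler0 !addr0.
Qed.

(** * Using extremality *)

Lemma krein_extensionE K : is_krein_extension ip S K -> K = krein_op.
Proof.
move=> [[[Ksa _] SK] Kmin].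
have K0 := krein_op_nonneg_sa_extension.
(* One inclusion suffices between self-adjoint operators. *)
apply/esym/sub_self_adjoint_eq => //; first by case: K0 => -[].
move=> [u w] [f /= [Sfw auf]].
have [/is_operatorP[Kl _] _ _] := Ksa.
have Kuf : K (u - f, 0).
  apply: (ker_le_op (Kmin _ K0)); exists 0; rewrite /= subr0; split=> //.
  by case: S_lin.
have : K (f + (u - f), w + 0) := graphD Kl (SK _ Sfw) Kuf.
by rewrite addr0 addrC subrK.
Qed.

(** Single-valuedness of the inverse amounts to [ker F = 0]. *)
Lemma friedrichs_extension_inv_operator F :
  is_friedrichs_extension ip S F -> is_operator (inv_op F).
Proof.
move=> [[[[/is_operatorP[Fl _] _ _] _] _] Fmax].
have kerF u : F (u, 0) -> u = 0.
  move=> Fu0; apply: ker_positive_extension.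
  exact: (ker_le_op (Fmax _ positive_extension_nonneg_sa_extension)).
apply/is_operatorP; split.
  split=> [|a p q]; first by case: Fl.
  by move=> Fp Fq; have := Fl.2 a _ _ Fp Fq.
move=> w u u' Fuw Fuw'; apply/eqP; rewrite -subr_eq0; apply/eqP/kerF.
have : F (u - u', w - w) := graphB Fl Fuw Fuw'.
by rewrite subrr.
Qed.

End PositiveOperator.
End InnerProduct.

(** * The correspondence of solutions *)

Theorem lemma3p1 (R : realType) (H : completeNormedModType R[i])
    (ip : {dot H for Num.conj})
    (normE : forall x : H, `|x| ^+ 2 = ip x x)
    (Hsep : separable H)
    (S SK SF : set (H * H)) (eps : R) (lam : R[i])
    (S_op : is_operator S)
    (S_dense : densely_defined S)
    (S_sym : symmetric_op ip S)
    (S_closed : closed S)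
    (S_defp : deficiency_index ip S 'i%C <> 0%E)
    (S_defm : deficiency_index ip S (- 'i%C) <> 0%E)
    (eps_gt0 : 0 < eps)
    (S_ge : bounded_below ip S eps)
    (SK_krein : is_krein_extension ip S SK)
    (SF_friedrichs : is_friedrichs_extension ip S SF)
    (lam_neq0 : lam <> 0) :
  let to_u v := app (inv_op SF) (app SK v) in
  let to_v u := lam^-1 *: app S u in
  let V := eigen_solutions SK lam in
  let U := pencil_solutions ip S lam in
  [/\ (exists v, v <> 0 /\ (dom SK v /\ app SK v = lam *: v)) <->
      (exists u, u <> 0 /\ (dom (comp_op (adj ip S) S) u /\
         app (comp_op (adj ip S) S) u = lam *: app S u)),
      is_operator (inv_op SF) /\
      (forall v, V v -> dom (inv_op SF) (app SK v)),
      [/\ set_bij V U to_u,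
          set_bij (V `\ 0) (U `\ 0) to_u,
          forall v, V v -> to_v (to_u v) = v
        & forall u, U u -> to_u (to_v u) = u]
    & (exists v, v <> 0 /\ V v) \/ (exists u, u <> 0 /\ U u) -> 0 < lam].
Proof.
move=> to_u to_v V U.
have SKE := krein_extensionE normE S_op S_dense S_sym S_closed eps_gt0 S_ge
  SK_krein.
have SFinv := friedrichs_extension_inv_operator normE S_op S_dense S_sym
  S_closed eps_gt0 S_ge SF_friedrichs.
have [[[SK_op _ _] SK_ge0] _] := SK_krein.1.
have [_ S_SF] := SF_friedrichs.1.
have /is_operatorP[S_lin _] := S_op.
have Sa_lin : linear_graph (adj ip S) := linear_graph_adj ip S.
have /eqP lam0 := lam_neq0.
(* [app] chooses a value, so it can be read off the graph only once that graph is single-valued; for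
   [S^*] this comes from density. *)
have SS_op : is_operator (comp_op (adj ip S) S).
  split=> [|a p q [w [Sw aw]] [w' [Sw' aw']]|].
  - by exists 0; case: S_lin; case: Sa_lin.
  - exists (a *: w + w'); split; first by have := S_lin.2 a _ _ Sw Sw'.
    by have := Sa_lin.2 a _ _ aw aw'.
  - move=> u w w' [v /= [Suv avw]] [v' [Suv' avw']].
    have [_ _ Sf] := S_op.
    move: avw'; rewrite -(Sf _ _ _ Suv Suv').
    exact: adj_functional avw.
have VP v : V v <-> SK (v, lam *: v).
  split=> [[dv <-]|Kv]; first exact: graph_app.
  by split; [exists (lam *: v)|exact: app_graph].
have UP u g : S (u, g) -> U u <-> adj ip S (g, lam *: g).
  move=> Sug; rewrite /U /pencil_solutions /= (app_graph S_op Sug).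
  split=> [[/graph_app[g' /= [Sug' ag']] E]|ag].
    have [_ _ Sf] := S_op.
    by rewrite E -(Sf _ _ _ Sug Sug') in ag'.
  have SSu : comp_op (adj ip S) S (u, lam *: g) by exists g.
  by split; [exists (lam *: g)|exact: app_graph].
have V_to_u v : V v ->
    [/\ S (to_u v, lam *: v), dom (inv_op SF) (app SK v) & U (to_u v)].
  move=> Vv; have [_ Ev] := Vv.
  have Kv : krein_op ip S (v, lam *: v) by rewrite -SKE; exact/VP.
  have av := krein_op_sub_adj S_sym Kv.
  have [f [/= Sf _]] := Kv.
  (* Since [S_K v = lam v = S f] and [S_F] extends [S], the vector [to_u v] is this [f]. *)
  have Fv : inv_op SF (lam *: v, f) by exact: S_SF.
  have Sv : S (to_u v, lam *: v) by rewrite /to_u Ev (app_graph SFinv Fv).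
  split=> //; first by rewrite Ev; exists f.
  by apply/(UP _ _ Sv); exact: graphZ Sa_lin av.
have U_to_v u : U u -> S (u, lam *: to_v u) /\ V (to_v u).
  move=> Uu; have [[w [g [/= Sug _]]] _] := Uu.
  have Sv : S (u, lam *: to_v u).
    by rewrite /to_v scalerA mulfV// scale1r (app_graph S_op Sug).
  split=> //; apply/VP; rewrite SKE; exists u; split=> //=.
  (* With [v = to_v u], both [S^* v] and [S^* u = S u] equal [lam v], so [v - u] lies in
     [ker S^*]. *)
  have : adj ip S (to_v u - u, lam *: to_v u - lam *: to_v u).
    suff av : adj ip S (to_v u, lam *: to_v u)
      by exact: graphB Sa_lin av (S_sym _ Sv).
    have : adj ip S (lam^-1 *: g, lam^-1 *: (lam *: g)).
      exact: graphZ Sa_lin ((UP _ _ Sug).1 Uu).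
    by rewrite /to_v (app_graph S_op Sug) !scalerA mulrC.
  by rewrite subrr.
have to_uK v : V v -> to_v (to_u v) = v.
  move=> /V_to_u[Sv _ _].
  by rewrite /to_v (app_graph S_op Sv) scalerA mulVf// scale1r.
have to_vK u : U u -> to_u (to_v u) = u.
  move=> /U_to_v[Su /V_to_u[Sv _ _]].
  have [_ _ S_inj] := SFinv.
  (* Both [to_u (to_v u)] and [u] are sent by [S_F] to [lam *: to_v u]. *)
  exact: S_inj (S_SF _ Sv) (S_SF _ Su).
have to_u_eq0 v : V v -> to_u v = 0 -> v = 0.
  by move=> /to_uK {2}<- ->; rewrite /to_v (app_graph S_op S_lin.1) scaler0.
have to_v_eq0 u : U u -> to_v u = 0 -> u = 0.
  move=> /U_to_v[Su _] v0; have [_ _ S_inj] := SFinv.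
  rewrite v0 scaler0 in Su; exact: S_inj (S_SF _ Su) (S_SF _ S_lin.1).
have inj : set_inj V to_u.
  by move=> v v' /set_mem/to_uK {2}<- /set_mem/to_uK {2}<- ->.
have VU : (exists v, v <> 0 /\ V v) <-> (exists u, u <> 0 /\ U u).
  split=> [[v [v0 Vv]]|[u [u0 Uu]]].
  - exists (to_u v); split; last by have [] := V_to_u _ Vv.
    by move=> /(to_u_eq0 _ Vv).
  - exists (to_v u); split; last by have [] := U_to_v _ Uu.
    by move=> /(to_v_eq0 _ Uu).
split=> //.
- by split=> // v /V_to_u[].
- split=> //.
  + split=> //.
    * by move=> v /V_to_u[].
    * by move=> u Uu; exists (to_v u); [have [] := U_to_v _ Uu|exact: to_vK].
  + split.
    * move=> v [Vv v0]; split; first by have [] := V_to_u _ Vv.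
      by move=> /(to_u_eq0 _ Vv).
    * by apply: sub_in2 inj => v /set_mem[Vv _]; exact: mem_set.
    * move=> u [Uu u0]; exists (to_v u); last exact: to_vK.
      by split; [have [] := U_to_v _ Uu|move=> /(to_v_eq0 _ Uu)].
- move=> sol.
  have [v [/eqP v0 /VP Kv]] : exists v, v <> 0 /\ V v by case: sol => // /VU.
  (* Here [0 <= <S_K v, v> = lam |v|^2]; in the order of [R[i]] this also makes [lam] real. *)
  have := SK_ge0 _ _ Kv; rewrite mul0r ipZl pmulr_lge0; last first.
    by rewrite -normE exprn_gt0// normr_gt0.
  by rewrite le_eqVlt eq_sym (negbTE lam0).
Qed.
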